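(* Let $q\in\mathbb{C}$ with $0<|q|<1$, let $n$ be a positive integer, let $A\in\mathbb{C}^{N\times N}$ be a positive stable matrix, and let $r$ be an integer with $0\le r\le n$. Then $$D_{z,q}^{r}J_{n,q}(z;A)=\frac{(q^{A-I};q)_{2r}}{(q-1)^{r}}\,q^{\binom{r}{2}-nr}\,J_{n-r,q}(z;A+2rI).$$
   Context: Fix a value of $\log q$ and put $q^{M}=e^{M\log q}$ for a square complex matrix $M$; $I$ is the identity matrix. A matrix is positive stable if all its eigenvalues have positive real part. For a square matrix $M$, $(M;q)_0=I$ and $(M;q)_k=\prod_{\tau=0}^{k-1}(I-q^{\tau}M)$; for scalars, $(q;q)_k=\prod_{\tau=1}^{k}(1-q^{\tau})$. For an integer $n\ge 0$ the $q$-Bessel matrix polynomials are $$J_{n,q}(z;A)=\frac{(q^{A-I};q)_{n}}{(q;q)_{n}}\sum_{k=0}^{\infty}\frac{(q^{-nI};q)_k(q^{A+(n-1)I};q)_k}{(q;q)_k}z^{k},$$ where the sum is finite since $(q^{-nI};q)_k=0$ for $k>n$. The $q$-derivative is $D_{z,q}f(z)=\frac{f(z)-f(qz)}{(1-q)z}$ for $z\neq0$, and $D_{z,q}f(0)=f'(0)$; $D_{z,q}^r$ is its $r$-th iterate. *)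

(* Defs.v *)
From HB Require Import structures.
From mathcomp Require Import all_boot all_order all_algebra.
From mathcomp Require Import complex.
From mathcomp Require Import all_classical all_reals all_analysis.

Set Implicit Arguments.
Unset Strict Implicit.
Unset Printing Implicit Defensive.

Import Order.TTheory GRing.Theory Num.Theory.
Import numFieldNormedType.Exports.

Local Open Scope classical_set_scope.
Local Open Scope ring_scope.

(* The complex numbers [R[i]], viewed through their [numClosedFieldType]
   structure: this makes the topological and normed structures that
   MathComp-Analysis provides on abstract number fields available on them
   (for the modulus, and hence the entrywise topology on matrices). *)
Definition Cplx (R : realType) : numClosedFieldType := R[i].

Definition cexp (R : realType) (z : Cplx R) : Cplx R :=
  lim (series (fun k : nat => z ^+ k / k`!%:R) @ \oo).

Definition expmx (R : realType) (N : nat) (M : 'M[Cplx R]_N) : 'M[Cplx R]_N :=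
  lim (series (fun k : nat => (k`!%:R)^-1 *: M ^+ k) @ \oo).

(* q^M = e^{M log q}, relative to the chosen value [logq] of log q. *)
Definition qpowmx (R : realType) (N : nat) (logq : Cplx R)
    (M : 'M[Cplx R]_N) : 'M[Cplx R]_N :=
  expmx (logq *: M).

Definition positive_stable (R : realType) (N : nat) (M : 'M[Cplx R]_N) : Prop :=
  forall a : Cplx R, eigenvalue M a -> 0 < 'Re a.

Definition qpochmx (R : realType) (N : nat) (q : Cplx R) (M : 'M[Cplx R]_N)
    (k : nat) : 'M[Cplx R]_N :=
  \prod_(0 <= t < k) (1%:M - q ^+ t *: M).

Definition qpochqq (R : realType) (q : Cplx R) (k : nat) : Cplx R :=
  \prod_(1 <= t < k.+1) (1 - q ^+ t).

(* The scalar n - 1 is taken in the field, not in [nat], because n may be 0. *)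
Definition qBessel (R : realType) (N : nat) (q logq : Cplx R) (n : nat)
    (A : 'M[Cplx R]_N) (z : Cplx R) : 'M[Cplx R]_N :=
  ((qpochqq q n)^-1 *: qpochmx q (qpowmx logq (A - 1%:M)) n) *m
  lim (series (fun k : nat =>
         (z ^+ k / qpochqq q k) *:
           (qpochmx q (qpowmx logq (- n%:R%:M)) k *m
            qpochmx q (qpowmx logq (A + (n%:R - 1)%:M)) k)) @ \oo).

(* [derive1] is taken over the field [Cplx R], so the value at 0 is the complex
   derivative f'(0). *)
Definition qderiv (R : realType) (N : nat) (q : Cplx R)
    (f : Cplx R -> 'M[Cplx R]_N) (z : Cplx R) : 'M[Cplx R]_N :=
  if z == 0 then derive1 f 0 else ((1 - q) * z)^-1 *: (f z - f (q * z)).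

(* Main.v *)
(* Put B = q^(A - I). Shifting A by an integer m multiplies q^A by q^m, which
   rests on the addition law exp(M + l I) = e^l exp(M). Hence, up to scalars, the
   coefficient of z^k in J_n(z; A) is (B; q)_n (q^n B; q)_k = (B; q)_(n+k). The
   r-th q-derivative moves the coefficient of index k + r to index k, and
   (B; q)_(n+k+r) = (B; q)_(2r) (q^(2r) B; q)_((n-r)+k) is the matching
   coefficient of J_(n-r)(z; A + 2rI); the remaining scalars agree because
   (q^(-n); q)_r (q; q)_(n-r) = (-1)^r q^(C(r,2) - nr) (q; q)_n. *)
Require Import Defs.
From HB Require Import structures.
From mathcomp Require Import all_boot all_order all_algebra.
From mathcomp Require Import complex.
From mathcomp Require Import all_classical all_reals all_analysis.
From mathcomp Require Import ring zify.

Set Implicit Arguments.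
Unset Strict Implicit.
Unset Printing Implicit Defensive.

Import Order.TTheory GRing.Theory Num.Theory.
Import numFieldNormedType.Exports.

Local Open Scope classical_set_scope.
Local Open Scope ring_scope.

(** * Convergence of complex and matrix sequences *)

Lemma cvg_mx_entrywise (K : numFieldType) (T : Type) (F : set_system T)
    (FF : Filter F) (m n : nat) (f : T -> 'M[K]_(m, n)) (l : 'M[K]_(m, n)) :
  (forall i j, f t i j @[t --> F] --> l i j) -> f t @[t --> F] --> l.
Proof.
move=> fl B [P lP PB]; rewrite /nbhs /=.
(* The neighbourhood contains a box of entry neighbourhoods [P i j]; the indices being finite in
   number, the entry conditions hold simultaneously near [F]. *)
have FP : \forall t \near F, forall i j, P i j (f t i j).
  apply: filter_forall => i; apply: filter_forall => j.
  exact: fl (lP i j).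
by apply: filterS FP => t Pt; apply: PB.
Qed.

Lemma normc_le_ReIm (R : realType) (a b : R) :
  `|(a +i* b)%C : Cplx R| <= (`|a| + `|b|)%:C%C.
Proof.
have -> : (a +i* b)%C = (a%:C + 'i * b%:C)%C :> Cplx R.
  by apply/eqP; rewrite eq_complex /=; apply/andP; split; apply/eqP; ring.
apply: le_trans (ler_normD _ _) _.
rewrite rmorphD /= lerD //.
  by rewrite normc_def /= expr0n addr0 sqrtr_sqr.
rewrite normrM normc_def /= expr0n add0r expr1n sqrtr1 mul1r.
by rewrite normc_def /= expr0n addr0 sqrtr_sqr.
Qed.

Lemma normc_ge_Im (R : realType) (z : Cplx R) : `|complex.Im z|%:C%C <= `|z|.
Proof.
rewrite normc_def lecR -sqrtr_sqr ler_wsqrtr // lerDr; exact: sqr_ge0.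
Qed.

(** In the order on [R[i]] a positive element is real, so the epsilon of a complex-valued norm
    estimate can be taken in [R]. *)
Lemma gt0_complexE (R : realType) (e : Cplx R) :
  0 < e -> exists2 d : R, 0 < d & e = d%:C%C.
Proof.
case: e => a b; rewrite ltcE /= => /andP[/eqP b0 a0]; exists a => //.
by rewrite b0.
Qed.

Lemma cvg_complex (R : realType) (u : nat -> Cplx R) (a b : R) :
  complex.Re (u n) @[n --> \oo] --> a -> complex.Im (u n) @[n --> \oo] --> b ->
  u n @[n --> \oo] --> ((a +i* b)%C : Cplx R).
Proof.
move=> ua ub; apply/cvgrPdist_lt => _ /gt0_complexE[d d0 ->].
have d20 : 0 < d / 2 by rewrite divr_gt0.
move/cvgrPdist_lt : ua => /(_ _ d20) ua.
move/cvgrPdist_lt : ub => /(_ _ d20) ub.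
near=> n.
have -> : ((a +i* b)%C : Cplx R) - u n =
   ((a - complex.Re (u n)) +i* (b - complex.Im (u n)))%C.
  by case: (u n).
apply: le_lt_trans (normc_le_ReIm _ _) _.
rewrite ltcR [ltRHS]splitr ltrD //; [by near: n|by near: n].
Unshelve. all: by end_near. Qed.

Lemma cvg_norm_dominated (R : realType) (V : normedModType (Cplx R))
    (u : nat -> V) (v : nat -> R) :
  (forall n, `|u n| <= (v n)%:C%C) -> v n @[n --> \oo] --> (0 : R) ->
  u n @[n --> \oo] --> (0 : V).
Proof.
move=> uv v0; apply/cvgrPdist_lt => _ /gt0_complexE[d d0 ->].
move/cvgrPdist_lt : v0 => /(_ _ d0) v0.
near=> n; rewrite sub0r normrN; apply: le_lt_trans (uv n) _.
rewrite ltcR; apply: le_lt_trans (ler_norm _) _.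
by rewrite -normrN -sub0r; near: n.
Unshelve. all: by end_near. Qed.

(** The real and imaginary parts are each dominated by [v], so the real comparison test applies to
    both, and the two limits recombine by [cvg_complex]. *)
Lemma is_cvg_series_complex_dominated (R : realType) (u : nat -> Cplx R)
    (v : nat -> R) :
  (forall n, `|u n| <= (v n)%:C%C) -> cvgn (series v) -> cvgn (series u).
Proof.
move=> uv cv.
have v0 n : 0 <= v n by rewrite -ler0c; apply: le_trans (uv n).
have dom (f : Cplx R -> R) : (forall z, `|f z|%:C%C <= `|z|) ->
    cvgn (series (fun n => f (u n))).
  move=> fle; apply: normed_cvg; apply: (series_le_cvg _ v0 _ cv) => n //=.
  by rewrite -lecR; exact: le_trans (fle _) (uv n).
have /cvg_ex[a ca] := dom _ (@normc_ge_Re R).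
have /cvg_ex[b cb] := dom _ (@normc_ge_Im R).
apply/cvg_ex; exists (a +i* b)%C.
apply: cvg_complex.
  apply: cvg_trans ca; apply: near_eq_cvg; apply: nearW => n.
  rewrite /series /= (big_morph (@complex.Re R) (id1 := 0) (op1 := +%R)) //.
  by move=> [? ?] [].
apply: cvg_trans cb; apply: near_eq_cvg; apply: nearW => n.
rewrite /series /= (big_morph (@complex.Im R) (id1 := 0) (op1 := +%R)) //.
by move=> [? ?] [].
Qed.

(** * Cauchy products of exponential series *)

(** Both sides run over the pairs with i + j < n, by antidiagonals and by rows; passing to n + 1
    lengthens each row by its term with i + j = n. *)
Lemma triangle_sum (V : nmodType) (F : nat -> nat -> V) (n : nat) :
  \sum_(0 <= k < n) \sum_(0 <= i < k.+1) F i (k - i)%N =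
  \sum_(0 <= i < n) \sum_(0 <= j < n - i) F i j.
Proof.
elim: n => [|n IH]; first by rewrite !big_nil.
rewrite big_nat_recr //= IH [RHS]big_nat_recr //= subSnn big_nat1.
rewrite (big_nat_recr n) //= subnn addrA -big_split /=; congr (_ + _).
apply: eq_big_nat => i /andP[_ i_n].
by rewrite subSn ?(ltnW i_n)// big_nat_recr.
Qed.

Lemma square_sub_triangle (V : zmodType) (F : nat -> nat -> V) (n : nat) :
  \sum_(0 <= i < n) \sum_(0 <= j < n) F i j -
    \sum_(0 <= k < n) \sum_(0 <= i < k.+1) F i (k - i)%N =
  \sum_(0 <= i < n) \sum_(n - i <= j < n) F i j.
Proof.
rewrite triangle_sum -sumrB; apply: eq_big_nat => i _.
by rewrite (big_cat_nat (leq0n _) (leq_subr i n)) /= addrC addrK.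
Qed.

Lemma invf_fact_bin (K : numFieldType) (k i : nat) : (i <= k)%N ->
  k`!%:R^-1 * 'C(k, i)%:R = i`!%:R^-1 * (k - i)`!%:R^-1 :> K.
Proof.
move=> ik; have fact_neq0 (j : nat) : (j`!)%:R != 0 :> K.
  by rewrite pnatr_eq0 -lt0n fact_gt0.
rewrite -(bin_fact ik) !natrM; field.
by rewrite !fact_neq0 pnatr_eq0 -lt0n bin_gt0 ik.
Qed.

Lemma exp_coeffD (R : realType) (a b : R) (k : nat) :
  exp_coeff (a + b) k =
  \sum_(0 <= i < k.+1) exp_coeff a i * exp_coeff b (k - i)%N.
Proof.
rewrite /exp_coeff /= addrC exprDn mulr_suml big_mkord; apply: eq_bigr => i _.
rewrite -mulr_natr.
have e := @invf_fact_bin R k i (ltn_ord i).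
transitivity (b ^+ (k - i) * a ^+ i * (k`!%:R^-1 * 'C(k, i)%:R)); first by ring.
by rewrite e; ring.
Qed.

(** Since [l%:M] commutes with [M], the binomial theorem turns the term into a Cauchy product
    coefficient. *)
Lemma expmx_termD (K : numFieldType) (N : nat) (M : 'M[K]_N) (l : K) (k : nat) :
  (k`!%:R)^-1 *: (M + l%:M) ^+ k =
  \sum_(0 <= i < k.+1) (l ^+ i / i`!%:R) *: ((k - i)`!%:R^-1 *: M ^+ (k - i)).
Proof.
rewrite exprDn_comm; last by rewrite /GRing.comm -!mulmxE scalar_mxC.
rewrite scaler_sumr big_mkord; apply: eq_bigr => i _.
have -> : (l%:M : 'M[K]_N) ^+ i = (l ^+ i)%:M.
  by elim: (i : nat) => [|j IH]; rewrite ?expr0 // !exprS IH -mulmxE -scalar_mxM.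
rewrite -mulmxE mul_mx_scalar scalerMnl !scalerA -[_ *+ 'C(_, _)]mulr_natr.
congr (_ *: _).
rewrite mulrCA invf_fact_bin ?mulrA //; by rewrite -ltnS.
Qed.

(** * The matrix exponential and its addition law *)

Lemma mx_exp_entry_le (R : realType) (N : nat) (M : 'M[Cplx R]_N) :
  exists b : R, 0 <= b /\ forall k i j, `|(M ^+ k) i j| <= (b ^+ k)%:C%C.
Proof.
(* The sum of the moduli of all entries bounds every row sum; being nonnegative, it comes from a
   real [b]. *)
have [b b0 Mb] : exists2 b : R, 0 <= b & b%:C%C = \sum_i \sum_j `|M i j|.
  have : 0 <= \sum_i \sum_j `|M i j| by apply: sumr_ge0 => i _; apply: sumr_ge0.
  case: (\sum_i _) => x y; rewrite lecE /= => /andP[/eqP y0 x0]; exists x => //.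
  by rewrite y0.
exists b; split => //; elim=> [|k IH] i j.
  rewrite expr0 mxE expr0; case: eqP => _; rewrite ?normr1 ?normr0 //.
rewrite exprS mxE; apply: le_trans (ler_norm_sum _ _ _) _.
apply: (@le_trans _ _ (\sum_u `|M i u| * (b ^+ k)%:C%C)).
  by apply: ler_sum => u _; rewrite normrM ler_wpM2l.
rewrite -mulr_suml exprS rmorphM /= ler_wpM2r ?ler0c ?exprn_ge0 // Mb.
rewrite [leRHS](bigD1 i) //= lerDl.
by apply: sumr_ge0 => u _; apply: sumr_ge0.
Qed.

Lemma norm_expc_term (R : realType) (l : Cplx R) (k : nat) :
  `|l ^+ k / k`!%:R| = (exp_coeff (complex.Re `|l|) k)%:C%C.
Proof.
rewrite normrM normrX normfV normr_nat /exp_coeff /= rmorphM rmorphXn fmorphV rmorph_nat.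
by congr (_ ^+ k / _).
Qed.

Lemma is_cvg_series_cexp (R : realType) (l : Cplx R) :
  cvgn (series (fun k : nat => l ^+ k / k`!%:R)).
Proof.
apply: (@is_cvg_series_complex_dominated _ _ (exp_coeff (complex.Re `|l|))).
  by move=> n; rewrite norm_expc_term.
exact: is_cvg_series_exp_coeff.
Qed.

Lemma norm_expmx_term_le (R : realType) (N : nat) (M : 'M[Cplx R]_N) (b : R) :
  (forall k i j, `|(M ^+ k) i j| <= (b ^+ k)%:C%C) ->
  forall k i j, `|(k`!%:R^-1 *: M ^+ k) i j| <= (exp_coeff b k)%:C%C.
Proof.
move=> Mb k i j; rewrite mxE normrM normfV normr_nat mulrC.
by rewrite /exp_coeff /= rmorphM fmorphV rmorph_nat ler_wpM2r // invr_ge0 ler0n.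
Qed.

Lemma is_cvg_series_expmx (R : realType) (N : nat) (M : 'M[Cplx R]_N) :
  cvgn (series (fun k : nat => k`!%:R^-1 *: M ^+ k)).
Proof.
have [b [_ /norm_expmx_term_le Mb]] := mx_exp_entry_le M.
have cM i j : cvgn (series (fun k => (k`!%:R^-1 *: M ^+ k) i j)).
  by apply: is_cvg_series_complex_dominated (is_cvg_series_exp_coeff b) => n.
apply/cvg_ex.
exists (\matrix_(i, j) limn (series (fun k => (k`!%:R^-1 *: M ^+ k) i j))).
apply: cvg_mx_entrywise => i j; rewrite mxE; apply: cvg_trans (cM i j).
by apply: near_eq_cvg; apply: nearW => n; rewrite /series /= summxE.
Qed.

(* The Cauchy product of the two series differs from the product of partial
   sums by the terms with i + j >= n, which are majorised by the same terms for
   the real series at [a] and [b]; those vanish in the limit by [expRD]. *)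
Lemma expmx_add_scalar (R : realType) (N : nat) (M : 'M[Cplx R]_N) (l : Cplx R) :
  expmx (M + l%:M) = cexp l *: expmx M.
Proof.
have [b [b0 /norm_expmx_term_le Mb]] := mx_exp_entry_le M.
pose a := complex.Re `|l|.
pose F i j := (l ^+ i / i`!%:R) *: (j`!%:R^-1 *: M ^+ j).
pose G i j := exp_coeff a i * exp_coeff b j.
pose rem (V : zmodType) (H : nat -> nat -> V) n :=
  \sum_(0 <= i < n) \sum_(n - i <= j < n) H i j.
have GE n : rem _ G n = series (exp_coeff a) n * series (exp_coeff b) n
    - series (exp_coeff (a + b)) n.
  rewrite /rem -square_sub_triangle; congr (_ - _).
    by rewrite /series /= mulr_suml; apply: eq_bigr => i _; rewrite mulr_sumr.
  by apply: eq_bigr => k _; rewrite exp_coeffD.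
have FE n : rem _ F n = series (fun k => l ^+ k / k`!%:R) n *:
    series (fun k => k`!%:R^-1 *: M ^+ k) n -
    series (fun k => k`!%:R^-1 *: (M + l%:M) ^+ k) n.
  rewrite /rem -square_sub_triangle; congr (_ - _).
    by rewrite /series /= scaler_suml; apply: eq_bigr => i _; rewrite scaler_sumr.
  by apply: eq_bigr => k _; rewrite expmx_termD.
have G0 : rem _ G n @[n --> \oo] --> (0 : R).
  rewrite (funext GE).
  rewrite -(subrr (expR (a + b))) [X in _ --> X - _]expRD.
  by apply: cvgB; [apply: cvgM|]; apply: is_cvg_series_exp_coeff.
have F0 : rem _ F n @[n --> \oo] --> (0 : 'M[Cplx R]_N).
  apply: cvg_mx_entrywise => i j; rewrite mxE.
  apply: cvg_norm_dominated G0 => n.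
  rewrite summxE rmorph_sum /=; apply: le_trans (ler_norm_sum _ _ _) _.
  apply: ler_sum => u _.
  rewrite summxE rmorph_sum /=; apply: le_trans (ler_norm_sum _ _ _) _.
  apply: ler_sum => v _.
  rewrite mxE normrM norm_expc_term.
  have -> : (G u v)%:C%C = (exp_coeff a u)%:C%C * (exp_coeff b v)%:C%C.
    exact: rmorphM.
  rewrite ler_wpM2l ?Mb //.
  by rewrite ler0c exp_coeff_ge0 // -ler0c RRe_real ?normr_real.
(* [rem _ F] tends to 0 and, by [FE], also to the difference of the two sides; limits are unique. *)
apply/eqP; rewrite -subr_eq0 -oppr_eq0 opprB; apply/eqP.
apply: (cvg_unique (@norm_hausdorff _ 'M[Cplx R]_N) _ F0).
rewrite (funext FE).
apply: cvgB; last exact: is_cvg_series_expmx.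
by apply: cvgZ; [exact: is_cvg_series_cexp|exact: is_cvg_series_expmx].
Qed.

(** * Finite series and integer shifts of the exponent *)

Lemma lim_series_finite (K : numFieldType) (V : normedModType K) (u : nat -> V)
    (n : nat) :
  (forall k, (n <= k)%N -> u k = 0) ->
  limn (series u) = \sum_(0 <= k < n) u k.
Proof.
move=> u0; apply: cvg_lim; first exact: norm_hausdorff.
apply: cvg_near_cst; near=> m.
have nm : (n <= m)%N by near: m; exact: nbhs_infty_ge.
rewrite /series /= (big_cat_nat (leq0n n) nm) /= [X in _ + X]big_nat.
by rewrite [X in _ + X]big1 ?addr0 // => k /andP[/u0].
Unshelve. all: by end_near. Qed.

Lemma expmx0 (R : realType) (N : nat) : expmx (0 : 'M[Cplx R]_N) = 1%:M.
Proof.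
rewrite /expmx (@lim_series_finite _ _ _ 1) => [|[//|k] _].
  by rewrite big_nat1 fact0 invr1 scale1r.
by rewrite exprS mul0r scaler0.
Qed.

Lemma qpowmx_add_nat (R : realType) (N : nat) (q logq : Cplx R) (M : 'M[Cplx R]_N)
    (n : nat) : cexp logq = q ->
  qpowmx logq (M + n%:R%:M) = q ^+ n *: qpowmx logq M.
Proof.
move=> <-; elim: n => [|n IH]; first by rewrite raddf0 addr0 scale1r.
rewrite exprS -scalerA -IH /qpowmx -expmx_add_scalar; congr expmx.
by rewrite -natr1 (raddfD (@scalar_mx _ N)) /= addrA scalerDr scale_scalar_mx mulr1.
Qed.

(** The shift law at M = -nI reads e^0 = q^n q^(-nI), and e^0 = I. *)
Lemma qpowmx_opp_nat (R : realType) (N : nat) (q logq : Cplx R) (n : nat) :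
  q != 0 -> cexp logq = q ->
  qpowmx logq (- n%:R%:M : 'M[Cplx R]_N) = (q ^- n)%:M.
Proof.
move=> q0 eq; have := qpowmx_add_nat (- n%:R%:M : 'M[Cplx R]_N) n eq.
rewrite addNr /qpowmx scaler0 expmx0 => /(congr1 ( *:%R (q ^- n))).
by rewrite scalerA mulVf ?expf_neq0 // scale1r scalemx1 => ->.
Qed.

(** * q-Pochhammer symbols and the coefficients of the q-Bessel polynomials *)

Lemma qpochmx_add (R : realType) (N : nat) (q : Cplx R) (M : 'M[Cplx R]_N)
    (a b : nat) :
  qpochmx q M (a + b) = qpochmx q M a *m qpochmx q (q ^+ a *: M) b.
Proof.
rewrite /qpochmx (big_cat_nat (leq0n a) (leq_addr b a)) /= mulmxE; congr (_ * _).
rewrite -{1}[a]add0n big_addn addKn; apply: eq_bigr => t _.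
by rewrite exprD scalerA.
Qed.

Lemma qpochmx_scalar (R : realType) (N : nat) (q x : Cplx R) (k : nat) :
  qpochmx q (x%:M : 'M[Cplx R]_N) k = (\prod_(0 <= t < k) (1 - q ^+ t * x))%:M.
Proof.
rewrite /qpochmx; elim: k => [|k IH]; first by rewrite !big_nil.
rewrite !big_nat_recr //= IH -mulmxE scalar_mxM; congr (_ *m _).
by rewrite raddfB /= scale_scalar_mx.
Qed.

Lemma qpochqqS (R : realType) (q : Cplx R) (k : nat) :
  qpochqq q k.+1 = qpochqq q k * (1 - q ^+ k.+1).
Proof. by rewrite /qpochqq big_nat_recr. Qed.

Lemma one_sub_expr_neq0 (R : realType) (q : Cplx R) (k : nat) :
  `|q| < 1 -> 1 - q ^+ k.+1 != 0.
Proof.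
move=> q1; rewrite subr_eq0; apply/eqP => e.
have : `|q ^+ k.+1| < 1 by rewrite normrX exprn_ilt1.
by rewrite -e normr1 ltxx.
Qed.

Lemma qpochqq_neq0 (R : realType) (q : Cplx R) (k : nat) :
  `|q| < 1 -> qpochqq q k != 0.
Proof.
move=> q1; elim: k => [|k IH]; first by rewrite /qpochqq big_nil oner_neq0.
by rewrite qpochqqS mulf_neq0 // one_sub_expr_neq0.
Qed.

Lemma qBesselE (R : realType) (N : nat) (q logq : Cplx R) (n : nat)
    (A : 'M[Cplx R]_N) (z : Cplx R) : q != 0 -> cexp logq = q ->
  qBessel q logq n A z =
  \sum_(0 <= k < n.+1) z ^+ k *:
    (((qpochqq q n * qpochqq q k)^-1 * \prod_(0 <= t < k) (1 - q ^+ t * q ^- n))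
      *: qpochmx q (qpowmx logq (A - 1%:M)) (n + k)).
Proof.
move=> q0 eq; rewrite /qBessel.
(* In this form q^(A + (n-1)I) becomes q^n B with B = q^(A - I), so that [qpochmx_add] applies. *)
have -> : A + (n%:R - 1)%:M = (A - 1%:M) + n%:R%:M.
  by rewrite raddfB /= addrA addrAC.
rewrite (qpowmx_add_nat _ _ eq) (qpowmx_opp_nat _ _ q0 eq) (@lim_series_finite _ _ _ n.+1).
  rewrite mulmx_sumr; apply: eq_bigr => k _.
  rewrite qpochmx_scalar mul_scalar_mx qpochmx_add -scalemxAl -!scalemxAr !scalerA.
  by congr (_ *: _); rewrite invfM; ring.
move=> k nk; rewrite qpochmx_scalar.
rewrite (big_cat_nat (leq0n n) (ltnW nk)) /= (@big_ltn _ _ _ n k) //.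
by rewrite divff ?expf_neq0 // subrr mul0r mulr0 raddf0 mul0mx scaler0.
Qed.

(** * Iterated q-derivatives of matrix polynomials *)

Lemma numField_exprn_continuous (K : numFieldType) (k : nat) :
  continuous (fun x : K => x ^+ k).
Proof.
elim: k => [|k IH] x; first exact: cst_continuous.
have -> : (fun y : K => y ^+ k.+1) = (fun y => y * y ^+ k).
  by apply/funext => y; rewrite exprS.
exact: (@continuousM K K id (fun y => y ^+ k) x _ (IH x)).
Qed.

Lemma qderiv_mxpoly (R : realType) (N : nat) (q : Cplx R) (m : nat)
    (c : nat -> 'M[Cplx R]_N) : q != 1 ->
  qderiv q (fun z => \sum_(0 <= k < m.+1) z ^+ k *: c k) =
  (fun z => \sum_(0 <= k < m) z ^+ k *: (((1 - q ^+ k.+1) / (1 - q)) *: c k.+1)).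
Proof.
move=> q1; apply/funext => z; rewrite /qderiv; case: eqP => [->|/eqP z0].
  apply: cvg_lim; first exact: norm_hausdorff.
  pose g (h : Cplx R) := \sum_(0 <= k < m) h ^+ k *: c k.+1.
  (* At 0 only the index 0 survives, and its weight (1 - q)/(1 - q) is 1. The value is thus [g 0],
     where [g h] is the ordinary difference quotient at 0 for h != 0. *)
  have -> : \sum_(0 <= k < m) 0 ^+ k *: (((1 - q ^+ k.+1) / (1 - q)) *: c k.+1) = g 0.
    apply: eq_bigr => -[|k] _; last by rewrite !expr0n !scale0r.
    by rewrite divff ?scale1r // subr_eq0 eq_sym.
  have gc : g h @[h --> 0^'] --> g 0.
    apply: cvg_within_filter.
    apply: cvg_big => [|k _].
      exact: add_continuous.
    by apply: cvgZr_tmp; exact: numField_exprn_continuous.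
  apply: cvg_trans gc; apply: near_eq_cvg; near=> h.
  have h0 : h != 0 by near: h; exact: nbhs_dnbhs_neq.
  rewrite /g -sumrB scaler_sumr [RHS]big_nat_recl //= !expr0 subrr scaler0 add0r.
  apply: eq_bigr => k _; rewrite addr0 expr0n scale0r subr0 scalerA.
  by rewrite exprS mulKf.
rewrite -sumrB scaler_sumr big_nat_recl //= !expr0 subrr scaler0 add0r.
apply: eq_bigr => k _; rewrite -scalerBl !scalerA exprMn; congr (_ *: _).
rewrite [z ^+ k.+1]exprS invfM.
transitivity ((z / z) * (z ^+ k * ((1 - q ^+ k.+1) / (1 - q)))); first by ring.
by rewrite divff // mul1r.
Unshelve. all: by end_near. Qed.

(** Peeling off the innermost derivative changes the coefficients, so the induction keeps [c]
    general; the factors 1 - q^j accumulate to (q; q)_(k+r) / (q; q)_k. *)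
Lemma iter_qderiv_mxpoly (R : realType) (N : nat) (q : Cplx R) (m r : nat)
    (c : nat -> 'M[Cplx R]_N) : `|q| < 1 ->
  iter r (qderiv q) (fun z => \sum_(0 <= k < m + r) z ^+ k *: c k) =
  (fun z => \sum_(0 <= k < m) z ^+ k *:
     ((qpochqq q (k + r) / (qpochqq q k * (1 - q) ^+ r)) *: c (k + r)%N)).
Proof.
move=> q1; elim: r c => [|r IH] c.
  apply/funext => z /=; rewrite addn0; apply: eq_bigr => k _.
  by rewrite addn0 expr0 mulr1 divff ?qpochqq_neq0 // scale1r.
have q_neq1 : q != 1 by apply: contraTneq q1 => ->; rewrite normr1 ltxx.
rewrite iterSr addnS (qderiv_mxpoly _ _ q_neq1).
rewrite (IH (fun k => ((1 - q ^+ k.+1) / (1 - q)) *: c k.+1)).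
apply/funext => z.
apply: eq_bigr => k _; congr (_ *: _); rewrite scalerA addnS; congr (_ *: _).
by rewrite qpochqqS [(1 - q) ^+ r.+1]exprS !invfM; ring.
Qed.

(** * The reversal identity and the comparison of coefficients *)

(** Each factor is 1 - q^(t-n) = -q^(t-n) (1 - q^(n-t)). The exponents t - n add up to C(r,2) - nr,
    and the factors 1 - q^(n-t) complete (q; q)_(n-r) to (q; q)_n. *)
Lemma qpoch_reversal (R : realType) (q : Cplx R) (n r : nat) :
  q != 0 -> (r <= n)%N ->
  \prod_(0 <= t < r) (1 - q ^+ t * q ^- n) * qpochqq q (n - r) =
  (-1) ^+ r * q ^ ('C(r, 2)%:Z - (n * r)%:Z) * qpochqq q n.
Proof.
move=> q0; elim: r => [|r IH] rn.
  by rewrite big_nil subn0 muln0 expr0 !mul1r.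
have := IH (ltnW rn); rewrite -(subnSK rn) qpochqqS big_nat_recr //=.
set P := \prod_(0 <= t < r) _; set Q := qpochqq q (n - r.+1).
rewrite (subnSK rn) => e.
have -> : q ^ ('C(r.+1, 2)%:Z - (n * r.+1)%:Z) =
   q ^ ('C(r, 2)%:Z - (n * r)%:Z) * q ^- (n - r).
  rewrite [q ^- (n - r)]exprnN -expfzDr //; congr (q ^ _).
  by rewrite binS bin1; lia.
have -> : q ^+ r * q ^- n = q ^- (n - r).
  rewrite -{1}(subnK (ltnW rn)) exprD invfM mulrCA divff ?mulr1 ?expf_neq0 //.
have u0 : q ^+ (n - r) != 0 by rewrite expf_neq0.
rewrite exprS.
transitivity (- q ^- (n - r) * (P * (Q * (1 - q ^+ (n - r))))).
  by field.
by rewrite e; ring.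
Qed.

Theorem theorem2p3 (R : realType) (q logq : Cplx R)
  (hq0 : 0 < `|q|) (hq1 : `|q| < 1) (hlogq : cexp logq = q)
  (n : nat) (hn : (0 < n)%N)
  (N : nat) (A : 'M[Cplx R]_N) (hA : positive_stable A)
  (r : nat) (hr : (r <= n)%N) (z : Cplx R) :
  iter r (qderiv q) (qBessel q logq n A) z =
    (((q - 1) ^+ r)^-1 *: qpochmx q (qpowmx logq (A - 1%:M)) (2 * r)) *m
    (q ^ ('C(r, 2)%:Z - (n * r)%:Z)
       *: qBessel q logq (n - r) (A + (2 * r)%:R%:M) z).
Proof.
have q0 : q != 0 by rewrite -normr_gt0.
(* The n + 1 terms are counted as (n - r + 1) + r, since each derivative removes one. *)
have -> : qBessel q logq n A = (fun z => \sum_(0 <= k < (n - r).+1 + r) z ^+ k *: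
    (((qpochqq q n * qpochqq q k)^-1 * \prod_(0 <= t < k) (1 - q ^+ t * q ^- n))
      *: qpochmx q (qpowmx logq (A - 1%:M)) (n + k))).
  by apply/funext => x; rewrite qBesselE // addSn subnK.
rewrite (iter_qderiv_mxpoly _ _ (fun k =>
  (((qpochqq q n * qpochqq q k)^-1 * \prod_(0 <= t < k) (1 - q ^+ t * q ^- n))
      *: qpochmx q (qpowmx logq (A - 1%:M)) (n + k))) hq1).
rewrite qBesselE // scaler_sumr mulmx_sumr; apply: eq_bigr => k _.
(* As (A + 2rI) - I = (A - I) + 2rI, the symbols on the right have base q^(2r) B and are absorbed by
   (B; q)_(2r). *)
rewrite addrAC (qpowmx_add_nat _ _ hlogq) -!scalemxAr -scalemxAl.
rewrite -qpochmx_add !scalerA.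
(* The matrix symbols now have the same length on both sides, which leaves a scalar identity. *)
have -> : (n + (k + r) = 2 * r + (n - r + k))%N by lia.
congr (_ *: _).
(* The first r factors feed the reversal identity; in the others q^(t+r) q^(-n) = q^t q^(-(n-r)), as
   required in degree n - r. *)
have -> : \prod_(0 <= t < k + r) (1 - q ^+ t * q ^- n) =
    \prod_(0 <= t < r) (1 - q ^+ t * q ^- n) *
    \prod_(0 <= t < k) (1 - q ^+ t * q ^- (n - r)).
  rewrite (big_cat_nat (leq0n r) (leq_addl k r)) /=; congr (_ * _).
  rewrite -{1}[r]add0n big_addn addnK; apply: eq_bigr => t _.
  rewrite -{1}(subnK hr) !exprD invfM; congr (1 - _).
  by field; rewrite !expf_neq0.
have e := qpoch_reversal q0 hr.
have Qn0 := qpochqq_neq0 n hq1; have Qnr0 := qpochqq_neq0 (n - r) hq1.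
have Qk0 := qpochqq_neq0 k hq1; have Qkr0 := qpochqq_neq0 (k + r) hq1.
have q1 : q - 1 != 0.
  by rewrite subr_eq0; apply: contraTneq hq1 => ->; rewrite normr1 ltxx.
(* The sign in (1 - q)^r = (-1)^r (q - 1)^r cancels the one from the reversal identity. *)
rewrite -[1 - q]opprB [(- (q - 1)) ^+ r]exprNn.
move: e Qn0 Qnr0 Qk0 Qkr0.
set P := \prod_(0 <= t < r) _; set S := \prod_(0 <= t < k) _.
set X := q ^ _; set D := (q - 1) ^+ r; set s := (-1) ^+ r.
have D0 : D != 0 by exact: expf_neq0.
have s0 : s != 0 by rewrite signr_eq0.
move=> e Qn0 Qnr0 Qk0 Qkr0.
have -> : P = s * X * qpochqq q n / qpochqq q (n - r) by rewrite -e mulfK.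
by field; rewrite Qn0 Qnr0 Qk0 Qkr0 D0 s0.
Qed.
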